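(* Suppose $X$ is a compact Hausdorff space. (1) If the set of $\mathfrak{q}$-points is dense in $X$, then every additive local multiplication $T$ on $C(X)$ has the form $T(f)=T(1)\operatorname{Re}(f)+T(i)\operatorname{Im}(f)$ for every $f\in C(X)$, for some $T(1),T(i)\in C(X)$. (2) If the set of strong $\mathfrak{q}$-points is dense in $X$, then $X$ is an $\eta$-space.
   Context: $C(X)$ denotes the algebra of complex-valued continuous functions on $X$. A map $T$ on $C(X)$ is additive if $T(f+g)=T(f)+T(g)$ for all $f,g$; it is a multiplication if there is $a\in C(X)$ with $T(f)=af$ for all $f\in C(X)$; it is a local multiplication if for each $f\in C(X)$ there is $a_f\in C(X)$ with $T(f)=a_f f$. A compact Hausdorff space $X$ is an $\eta$-space if every additive local multiplication on $C(X)$ is a multiplication. A point $x\in X$ is a $\mathfrak{q}$-point if there is a sequence $\{K_n\}_{n\in\mathbb{N}}$ of pairwise disjoint compact subsets of $X$ such that (i) each $K_n$ is disjoint from the closure of $\bigcup_{m\in\mathbb{N},\,m\neq n}K_m$, and (ii) $x\in\overline{\bigcup_{n\in\mathbb{N}}K_n}\setminus\bigcup_{n\in\mathbb{N}}K_n$. The point $x$ is a strong $\mathfrak{q}$-point if there is such a sequence, satisfying (i) and (ii), which also satisfies (iii) $x\in\overline{\bigcup_{n\in\mathbb{N}}K_{2n}}\cap\overline{\bigcup_{n\in\mathbb{N}}K_{2n-1}}$. Here $\mathbb{N}$ is the set of positive integers. *)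

(* Defs.v *)
From HB Require Import structures.
From mathcomp Require Import all_boot all_order all_algebra.
From mathcomp Require Import complex.
From mathcomp Require Import all_classical all_reals all_analysis.

Set Implicit Arguments.
Unset Strict Implicit.
Unset Printing Implicit Defensive.

Import Order.TTheory GRing.Theory Num.Theory.

Local Open Scope classical_set_scope.
Local Open Scope ring_scope.

(* The regular algebra [R[i]^o] is the type of complex numbers on which the
   library puts the topology of the modulus; [R[i]] itself carries none.       *)
Notation CX R X := (continuousType X (complex R)^o).

Section CX_ring.
Variables (R : realType) (X : topologicalType).
Implicit Types f g h : CX R X.

Lemma cx_continuous f : continuous (f : X -> R[i]^o).
Proof. exact: cts_fun. Qed.

Definition mk_cx (u : X -> R[i]^o) (cu : continuous u) : CX R X :=
  [the continuousType X R[i]^o of mkcts cu].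

Lemma cx_eq f g : (forall x, f x = g x) -> f = g.
Proof. by move=> fg; apply/continuousEP. Qed.

Lemma cx_cst_continuous (c : R[i]) : continuous (fun _ : X => c : R[i]^o).
Proof. by move=> x; exact: cvg_cst. Qed.

Lemma cx_add_continuous f g : continuous (fun x => f x + g x : R[i]^o).
Proof. by move=> x; apply: cvgD; exact: cx_continuous. Qed.

Lemma cx_opp_continuous f : continuous (fun x => - f x : R[i]^o).
Proof. by move=> x; apply: cvgN; exact: cx_continuous. Qed.

Lemma cx_mul_continuous f g : continuous (fun x => f x * g x : R[i]^o).
Proof.
move=> x.
apply: (@cvgM R[i] X (nbhs x) _ f g); exact: cx_continuous.
Qed.

Lemma norm_real_complex (a : R) : `|a%:C%C : R[i]| = `|a|%:C%C.
Proof. by rewrite normc_def /= expr0n addr0 sqrtr_sqr. Qed.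

Lemma normc_ge_Im (z : R[i]) : `|complex.Im z|%:C%C <= `|z|.
Proof.
have := normc_ge_Re (z * 'i%C); rewrite ReiNIm normrN normrM.
by rewrite [X in _ * X]normc_def /= expr0n expr1n add0r sqrtr1 mulr1.
Qed.

Lemma cx_Re_continuous f :
  continuous (fun x => (complex.Re (f x))%:C%C : R[i]^o).
Proof.
move=> x; apply/cvgrPdist_lt => e e0.
have /cvgrPdist_lt/(_ e e0) := @cx_continuous f x.
apply: filterS => t; apply: le_lt_trans.
rewrite -rmorphB norm_real_complex -raddfB; exact: normc_ge_Re.
Qed.

Lemma cx_Im_continuous f :
  continuous (fun x => (complex.Im (f x))%:C%C : R[i]^o).
Proof.
move=> x; apply/cvgrPdist_lt => e e0.
have /cvgrPdist_lt/(_ e e0) := @cx_continuous f x.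
apply: filterS => t; apply: le_lt_trans.
rewrite -rmorphB norm_real_complex -raddfB; exact: normc_ge_Im.
Qed.

Definition cx_cst (c : R[i]) : CX R X := mk_cx (@cx_cst_continuous c).
Definition cx_add f g : CX R X := mk_cx (@cx_add_continuous f g).
Definition cx_opp f : CX R X := mk_cx (@cx_opp_continuous f).
Definition cx_mul f g : CX R X := mk_cx (@cx_mul_continuous f g).
Definition cx_Re f : CX R X := mk_cx (@cx_Re_continuous f).
Definition cx_Im f : CX R X := mk_cx (@cx_Im_continuous f).

Lemma cx_addA : associative cx_add.
Proof. by move=> f g h; apply: cx_eq => x; exact: addrA. Qed.
Lemma cx_addC : commutative cx_add.
Proof. by move=> f g; apply: cx_eq => x; exact: addrC. Qed.
Lemma cx_add0 : left_id (cx_cst 0) cx_add.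
Proof. by move=> f; apply: cx_eq => x; exact: add0r. Qed.
Lemma cx_addN : left_inverse (cx_cst 0) cx_opp cx_add.
Proof. by move=> f; apply: cx_eq => x; exact: addNr. Qed.

HB.instance Definition _ :=
  GRing.isZmodule.Build (CX R X) cx_addA cx_addC cx_add0 cx_addN.

Lemma cx_mulA : associative cx_mul.
Proof. by move=> f g h; apply: cx_eq => x; exact: mulrA. Qed.
Lemma cx_mulC : commutative cx_mul.
Proof. by move=> f g; apply: cx_eq => x; exact: mulrC. Qed.
Lemma cx_mul1 : left_id (cx_cst 1) cx_mul.
Proof. by move=> f; apply: cx_eq => x; exact: mul1r. Qed.
Lemma cx_mulD : left_distributive cx_mul +%R.
Proof. by move=> f g h; apply: cx_eq => x; exact: mulrDl. Qed.

(* "Pz" because the ring is trivial when [X] is empty. *)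
HB.instance Definition _ :=
  GRing.Zmodule_isComPzRing.Build (CX R X) cx_mulA cx_mulC cx_mul1 cx_mulD.

Lemma cxDE f g x : (f + g) x = f x + g x. Proof. by []. Qed.
Lemma cxME f g x : (f * g) x = f x * g x. Proof. by []. Qed.
Lemma cx1E x : (1 : CX R X) x = 1. Proof. by []. Qed.
Lemma cx_cstE c x : cx_cst c x = c. Proof. by []. Qed.
Lemma cx_ReE f x : cx_Re f x = (complex.Re (f x))%:C%C. Proof. by []. Qed.
Lemma cx_ImE f x : cx_Im f x = (complex.Im (f x))%:C%C. Proof. by []. Qed.

Definition additive_map (T : CX R X -> CX R X) : Prop :=
  forall f g, T (f + g) = T f + T g.

Definition multiplication (T : CX R X -> CX R X) : Prop :=
  exists a : CX R X, forall f, T f = a * f.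

Definition local_multiplication (T : CX R X -> CX R X) : Prop :=
  forall f, exists a : CX R X, T f = a * f.

End CX_ring.

Definition eta_space (R : realType) (X : topologicalType) : Prop :=
  [/\ compact [set: X], hausdorff_space X &
      forall T : CX R X -> CX R X,
        additive_map T -> local_multiplication T -> multiplication T].

Section q_points.
Variable X : topologicalType.

(* Sequences are indexed from 0, so [K n] is the (n+1)-st compact set; this
   exchanges the even-indexed and the odd-indexed families in
   [strong_q_point], which is symmetric in them. The [K n] may be empty.       *)
Definition q_sequence (K : nat -> set X) (x : X) : Prop :=
  [/\ forall n, compact (K n),
      trivIset setT K,
      forall n, K n `&` closure (\bigcup_(m in [set m | m <> n]) K m) = set0 &
      (closure (\bigcup_n K n) `\` \bigcup_n K n) x].

Definition q_point (x : X) : Prop :=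
  exists K : nat -> set X, q_sequence K x.

Definition strong_q_point (x : X) : Prop :=
  exists K : nat -> set X, q_sequence K x /\
    (closure (\bigcup_n K n.*2) `&` closure (\bigcup_n K n.*2.+1)) x.

End q_points.

(* Main.v *)
From HB Require Import structures.
Require Import Defs.
From mathcomp Require Import all_boot all_order all_algebra.
From mathcomp Require Import complex ring.
From mathcomp Require Import all_classical all_reals all_analysis.

Set Implicit Arguments.
Unset Strict Implicit.
Unset Printing Implicit Defensive.

Import Order.TTheory GRing.Theory Num.Theory.
Import Normc numFieldNormedType.Exports.

Local Open Scope classical_set_scope.
Local Open Scope ring_scope.

(** A value [T f x] depends on [f x] only: [f - f x] vanishes at [x], hence so
    does its multiple [T (f - f x)].  Thus [T] amounts to a family of additive
    maps [fiber T x : R[i] -> R[i]], with [T f x = fiber T x (f x)], and for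
    fixed [c] the value [fiber T x c] is continuous in [x].

    Let [K] be the sequence of a q-point [x].  Tietze's theorem on the closure
    of the union of the [K n] yields a continuous [f] with prescribed constant
    values [c n] on the sets [K n], as soon as [c n] tends to 0
    ([complex_interpolation]).  Writing [T f = a f] with [a] continuous, hence
    bounded by compactness, [|fiber T y (c n)|] is at most a constant times
    [|c n|], uniformly in [n] and in [y] in [K n].

    If [fiber T x] were unbounded, then for each [N] some [c] would satisfy
    [|fiber T x c| > N |c|]; the inequality persists near [x], thus on points of
    [K m] for arbitrarily large [m], and it survives division of [c] by an
    integer, so that [c] can be taken as small as [m] demands.  A diagonal
    choice of [c m] then contradicts the bound ([fiber_bounded]).  A bounded
    additive map is real-linear ([additive_bounded_real_linear]), which is the
    formula of the first part at [x]; both sides being continuous, density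
    gives it everywhere.

    At a strong q-point, take [f] equal to [1 / (n + 1)] on the even [K n] and to
    [i / (n + 1)] on the odd ones.  If [T f = a f], additivity gives [T 1 = a] on
    the even sets and [T i = a i] on the odd ones.  As [x] adheres to both
    unions, [T i = i T 1] at [x] ([strong_q_point_i]), hence everywhere by
    density, and the formula of the first part collapses to [T f = T 1 f]. *)

(** * The real-valued modulus of complex numbers *)

Section modulus.
Variable R : realType.
Implicit Types (z w : R[i]) (r : R).

(** The order of [R[i]] is partial, so estimates are made with the modulus
    [normc], which takes its values in [R]. *)
Lemma norm_normc z : `|z| = (normc z)%:C%C.
Proof. by []. Qed.

Lemma normc_ge0 z : 0 <= normc z.
Proof. by case: z => a b; exact: sqrtr_ge0. Qed.

Lemma normcD_le z w : normc (z + w) <= normc z + normc w.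
Proof. exact: (@le_normcD R z w). Qed.

Lemma normc_real r : normc r%:C%C = `|r|.
Proof. by rewrite /= expr0n addr0 sqrtr_sqr. Qed.

Lemma normc_i : normc ('i%C : R[i]) = 1.
Proof. by rewrite /= expr0n expr1n add0r sqrtr1. Qed.

Lemma normc_nat (n : nat) : normc (n%:R : R[i]) = n%:R.
Proof. by rewrite -(rmorph_nat (real_complex R)) normc_real normr_nat. Qed.

Lemma normcB_dist z w : `|normc z - normc w| <= normc (z - w).
Proof.
have := @ler_dist_dist R[i] R[i] z w.
have dE : `|z| - `|w| = (normc z - normc w)%:C%C by rewrite rmorphB.
by rewrite dE norm_real_complex [X in _ <= X]norm_normc lecR.
Qed.

Lemma Re_normc_le z : `|complex.Re z| <= normc z.
Proof. by have := normc_ge_Re z; rewrite norm_normc lecR. Qed.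

Lemma Im_normc_le z : `|complex.Im z| <= normc z.
Proof. by have := normc_ge_Im z; rewrite norm_normc lecR. Qed.

(** The defect [D = g (r c) - r (g c)] satisfies [n D = g (t c) - t (g c)], where
    [t] is the fractional part of [n r], because [g] commutes with integer
    multiples.  Hence [n D] is bounded independently of [n]. *)
Lemma additive_bounded_real_linear (g : {additive R[i] -> R[i]}) (M : R) :
  (forall c, normc (g c) <= M * normc c) ->
  forall r c, g (r%:C%C * c) = r%:C%C * g c.
Proof.
move=> gM r c; apply/eqP; rewrite -subr_eq0; apply/eqP/eq0_normc.
set D := _ - _; apply/eqP; rewrite eq_le normc_ge0 andbT leNgt.
apply/negP => D0.
pose B := 2 * `|M| * normc c.
have nD (n : nat) : n%:R * normc D <= B.
  pose t := n%:R * r - (Num.floor (n%:R * r))%:~R.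
  have /andP[t0 t1] : 0 <= t <= 1.
    rewrite /t subr_ge0 floor_le_tmp /= lerBlDl.
    by have := floorD1_gt (n%:R * r); rewrite intrD => /ltW.
  have nE : n%:R * D = g (t%:C%C * c) - t%:C%C * g c.
    have tE : t%:C%C = n%:R * r%:C%C - (Num.floor (n%:R * r))%:~R :> R[i].
      by rewrite /t rmorphB rmorphM rmorph_nat rmorph_int.
    have -> : t%:C%C * c = (r%:C%C * c) *+ n - c *~ Num.floor (n%:R * r).
      by rewrite tE mulrBl -mulrA mulrzl -[_ * c *+ n]mulr_natl.
    rewrite raddfB raddfMn raddfMz -mulr_natl -mulrzl tE /D; ring.
  rewrite -[n%:R]normc_nat -normcM nE.
  apply: le_trans (normcD_le _ _) _.
  have tB c' : 0 <= c' -> t * c' <= c' by move=> c'0; rewrite ler_piMl.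
  have gM' c' : normc (g c') <= `|M| * normc c'.
    apply: le_trans (gM c') _.
    by rewrite ler_wpM2r ?normc_ge0 ?ler_norm.
  rewrite normcN normcM normc_real ger0_norm // /B -mulrA mulr_natl mulr2n.
  apply: lerD.
    apply: le_trans (gM' _) _; rewrite ler_wpM2l //.
    by rewrite normcM normc_real ger0_norm // tB // normc_ge0.
  by apply: le_trans (gM' c); rewrite tB // normc_ge0.
have B0 : 0 <= B / normc D.
  by rewrite divr_ge0 ?normc_ge0 // !mulr_ge0 ?normc_ge0.
have := archi_boundP B0; rewrite ltr_pdivrMr // ltNge.
by move/negP; apply; exact: nD.
Qed.

End modulus.

(** * Interpolation on a separated sequence of closed sets *)

Section interpolation.
Variable X : topologicalType.

(** The function with value [r n] on [K n] and 0 elsewhere is continuous on the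
    closure [F] of the union: [K n] is relatively open in [F], and near a point of
    no [K n] only large indices occur, for which [r n] is small. *)
Lemma tietze_sequence (R : realType) (K : nat -> set X) (r : nat -> R) :
  normal_space X ->
  (forall n, closed (K n)) ->
  (forall n, K n `&` closure (\bigcup_(m in [set m | m <> n]) K m) = set0) ->
  r @ \oo --> (0 : R) ->
  exists u : X -> R^o, continuous u /\ forall n y, K n y -> u y = r n.
Proof.
move=> normX clK sepK r0.
pose F := closure (\bigcup_n K n).
pose h y : R^o := if pselect (exists n, K n y) is left e
                  then r (projT1 (cid e)) else 0.
have hK n y : K n y -> h y = r n.
  move=> Kny; rewrite /h; case: pselect => [e|]; last by case; exists n.
  case: cid => m /= Kmy; congr r; apply: contrapT => mn.
  have : (K n `&` closure (\bigcup_(m in [set m | m <> n]) K m)) y.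
    by split=> //; apply: subset_closure; exists m.
  by rewrite sepK.
have [M M0 rM] : exists2 M : R, 0 < M & forall n, `|r n| <= M.
  have /cvg_seq_bounded[M [_ rM]] : cvgn r by apply/cvg_ex; exists 0.
  exists (`|M| + 1); first by rewrite ltr_wpDl.
  by move=> n; apply: rM => //; apply: le_lt_trans (ler_norm M) _; rewrite ltrDl.
have hM y : F y -> `|h y| <= M.
  move=> _; rewrite /h; case: pselect => [e|_]; first exact: rM.
  by rewrite normr0 ltW.
have hcont : {within F, continuous h}.
  apply/subspace_continuousP => x Fx.
  apply/cvgrPdist_lt => e e0; rewrite /from_subspace.
  have [[n Knx]|nKx] := pselect (exists n, K n x).
    (* [F] is covered by [K n] and the closure [C] of the others, which misses [x] *)
    pose C := closure (\bigcup_(m in [set m | m <> n]) K m).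
    have nC : nbhs x (~` C).
      apply: open_nbhs_nbhs; split.
        by apply: closed_openC; exact: closed_closure.
      by move=> Cx; have : (K n `&` C) x by []; rewrite sepK.
    have FKC : F `<=` K n `|` C.
      have -> : K n `|` C = closure (K n `|` \bigcup_(m in [set m | m <> n]) K m).
        by rewrite closureU -(proj1 (closure_id _) (clK n)).
      apply: closureS => y [m _ Kmy].
      by have [<-|mn] := pselect (m = n); [left|right; exists m].
    move: nC; apply: filterS => y nCy Fy.
    have [Kny|//] := FKC _ Fy.
    by rewrite /= (hK _ _ Knx) (hK _ _ Kny) subrr normr0.
  have h0 y : ~ (exists n, K n y) -> h y = 0 by rewrite /h; case: pselect.
  move/cvgrPdist_lt: r0 => /(_ e e0) [N _ rN].
  have nD : nbhs x (~` \bigcup_(n in `I_N) K n).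
    apply: open_nbhs_nbhs; split.
      by apply: closed_openC; apply: closed_bigcup => // n _; exact: clK.
    by move=> [n _ Knx]; apply: nKx; exists n.
  move: nD; apply: filterS => y nDy Fy /=; rewrite (h0 x) //.
  have [[n Kny]|/h0 ->] := pselect (exists n, K n y); last by rewrite subrr normr0.
  rewrite (hK n) //; apply: rN => /=; rewrite leqNgt; apply/negP => nN.
  by apply: nDy; exists n.
have [u [uh uc _]] :=
  continuous_bounded_extension normX (@closed_closure _ _) M0 hcont hM.
exists u; split=> // n y Kny; rewrite -uh ?(hK n) //.
by apply/mem_set; apply: subset_closure; exists n.
Qed.

Lemma real_complex_continuous (R : realType) (u : X -> R^o) :
  continuous u -> continuous (fun x => (u x)%:C%C : R[i]^o).
Proof.
move=> cu x; apply/cvgrPdist_lt => e e0.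
have eE : e = (complex.Re e)%:C%C.
  by move: e0; case: e => a b; rewrite ltcE /= => /andP[/eqP -> _].
have /cvgrPdist_lt/(_ (complex.Re e)) := cu x.
move: e0; rewrite eE ltcR /= => e0 /(_ e0); apply: filterS => t.
by rewrite -rmorphB norm_real_complex ltcR.
Qed.

Lemma complex_interpolation (R : realType) (K : nat -> set X) (c : nat -> R[i]) :
  normal_space X ->
  (forall n, closed (K n)) ->
  (forall n, K n `&` closure (\bigcup_(m in [set m | m <> n]) K m) = set0) ->
  (fun n => normc (c n)) @ \oo --> (0 : R) ->
  exists f : CX R X, forall n y, K n y -> f y = c n.
Proof.
move=> normX clK sepK c0.
have part0 (p : R[i] -> R) : (forall z, `|p z| <= normc z) ->
    (fun n => p (c n)) @ \oo --> (0 : R).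
  move=> pc; apply/cvgrPdist_lt => e e0.
  move/cvgrPdist_lt: c0 => /(_ e e0); apply: filterS => n.
  rewrite !sub0r !normrN ger0_norm ?normc_ge0 //.
  exact: le_lt_trans (pc _).
have [u [uc uK]] := tietze_sequence normX clK sepK (part0 _ (@Re_normc_le R)).
have [v [vc vK]] := tietze_sequence normX clK sepK (part0 _ (@Im_normc_le R)).
exists (mk_cx (real_complex_continuous uc) +
        cx_cst X 'i%C * mk_cx (real_complex_continuous vc)) => n y Kny.
rewrite -[LHS]/((u y)%:C%C + 'i%C * (v y)%:C%C).
by rewrite (uK n) // (vK n) // [RHS]complexE.
Qed.

End interpolation.

(** * Points adherent to a separated sequence *)

(** Finitely many of the compact sets have a closed union that misses [x], so
    the neighbourhoods of [x] must meet sets of arbitrarily large index. *)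
Lemma q_sequence_tail (X : topologicalType) (K : nat -> set X) x (U : set X) N :
  hausdorff_space X -> q_sequence K x -> nbhs x U ->
  exists m, (N <= m)%N /\ exists2 y, K m y & U y.
Proof.
move=> hausX [cK _ _ [xK nKx]] Ux.
have nD : nbhs x (~` \bigcup_(n in `I_N) K n).
  apply: open_nbhs_nbhs; split.
    apply: closed_openC; apply: closed_bigcup => // n _.
    exact: compact_closed (cK n).
  by move=> [n _ Knx]; apply: nKx; exists n.
have [y [[m _ Kmy] [Uy nDy]]] := xK _ (filterI Ux nD).
exists m; split; last by exists y.
by rewrite leqNgt; apply/negP => mN; apply: nDy; exists m.
Qed.

Lemma strong_q_point_q_point (X : topologicalType) (x : X) :
  strong_q_point x -> q_point x.
Proof. by move=> [K [qK _]]; exists K. Qed.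

(** * Complex-valued continuous functions *)

Section continuous_functions.
Variables (R : realType) (X : topologicalType).
Implicit Types f g : CX R X.

Lemma normc_continuous f : continuous (fun x => normc (f x) : R^o).
Proof.
move=> x; apply/cvgrPdist_lt => e e0.
have /cvgrPdist_lt/(_ e%:C%C) := @cx_continuous R X f x.
rewrite ltcR => /(_ e0); apply: filterS => t.
by rewrite norm_normc ltcR; apply: le_lt_trans (normcB_dist _ _).
Qed.

(** The modulus of [f - g] at an adherent point [x] cannot be positive, since by
    continuity it would be positive at some point of [A]. *)
Lemma eq_on_closure (A : set X) f g :
  (forall x, A x -> f x = g x) -> forall x, closure A x -> f x = g x.
Proof.
move=> fg x Ax; apply/eqP; rewrite -subr_eq0; apply/eqP/eq0_normc/eqP.
rewrite eq_le normc_ge0 andbT leNgt; apply/negP => fg0.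
have /cvgrPdist_lt/(_ _ fg0)/Ax[y [Ay]] := @normc_continuous (f - g) x.
rewrite -[(f - g) x]/(f x - g x) -[(f - g) y]/(f y - g y).
by rewrite (fg y Ay) subrr normc0 subr0 ger0_norm ?ltxx // normc_ge0.
Qed.

Lemma eq_on_dense (A : set X) f g :
  dense A -> (forall x, A x -> f x = g x) -> f = g.
Proof.
move=> dA fg; apply: cx_eq => x; apply: (eq_on_closure fg) => B Bx.
have [|y [By Ay]] := dA _ _ (open_interior B); first by exists x.
by exists y; split=> //; exact: interior_subset.
Qed.

Lemma normc_bounded f : compact [set: X] ->
  exists M : R, forall x, normc (f x) <= M.
Proof.
move=> cptX.
have : compact [set (normc (f x) : R^o) | x in [set: X]].
  apply: continuous_compact => //; apply: continuous_subspaceT.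
  exact: normc_continuous.
move/compact_bounded => [M [_ fM]]; exists (M + 1) => x.
apply: le_trans (ler_norm _) _; apply: (fM (M + 1)); last by exists x.
by rewrite ltrDl.
Qed.

End continuous_functions.

(** * Additive local multiplications, pointwise *)

Section additive_local_multiplications.
Variables (R : realType) (X : topologicalType) (T : CX R X -> CX R X).
Hypotheses (Tadd : additive_map T) (Tloc : local_multiplication T).
Hypothesis cptX : compact [set: X].

Lemma cx_cstB (c d : R[i]) : cx_cst X (c - d) = cx_cst X c - cx_cst X d.
Proof. exact: cx_eq. Qed.

Lemma additive_mapB (f g : CX R X) : T (f - g) = T f - T g.
Proof. by apply/eqP; rewrite -subr_eq opprK -Tadd subrK. Qed.

(** The additive map by which [T] acts on the values of functions at [x]; see
    [local_multiplication_fiber]. *)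
Definition fiber (x : X) (c : R[i]) : R[i] := T (cx_cst X c) x.

Lemma fiber_is_zmod_morphism x : zmod_morphism (fiber x).
Proof. by move=> c d; rewrite /fiber cx_cstB additive_mapB. Qed.

HB.instance Definition _ x :=
  GRing.isZmodMorphism.Build R[i] R[i] (fiber x) (fiber_is_zmod_morphism x).

(** [T] maps [f - f x], which vanishes at [x], to a multiple of itself. *)
Lemma local_multiplication_fiber (f : CX R X) x : T f x = fiber x (f x).
Proof.
apply/eqP; rewrite -subr_eq0; apply/eqP.
rewrite -[LHS]/((T f - T (cx_cst X (f x))) x) -additive_mapB.
have [a ->] := Tloc (f - cx_cst X (f x)).
by rewrite -[LHS]/(a x * (f x - f x)) subrr mulr0.
Qed.

(** The bound is that of the continuous multiplier of [f]. *)
Lemma local_multiplication_bounded (f : CX R X) :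
  exists N : nat, forall x, normc (fiber x (f x)) <= N%:R * normc (f x).
Proof.
have [a Tf] := Tloc f; have [M aM] := normc_bounded a cptX.
exists (Num.bound `|M|) => x.
rewrite -local_multiplication_fiber Tf -[(a * f) x]/(a x * f x) normcM.
rewrite ler_wpM2r ?normc_ge0 //; apply: le_trans (aM x) _.
by apply: le_trans (ler_norm M) _; apply/ltW/archi_boundP.
Qed.

(** The expansion factor of [fiber x] at [c] is unchanged when [c] is divided by a
    positive integer, so that it is also attained at arbitrarily small values. *)
Lemma fiber_expansion_small x (N : nat) c e : 0 < e ->
  N%:R * normc c < normc (fiber x c) ->
  exists d, normc d <= e /\ N%:R * normc d < normc (fiber x d).
Proof.
move=> e0 Nc.
pose k := (Num.bound (normc c / e)).+1.
have k0 : 0 < k%:R :> R by rewrite ltr0n.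
have [d cE] : exists d, c = d *+ k.
  by exists (c / k%:R); rewrite -[RHS]mulr_natr mulfVK // pnatr_eq0.
have ck : normc c = k%:R * normc d.
  by rewrite cE -[d *+ k]mulr_natl normcM normc_nat.
exists d; split.
  rewrite -(ler_pM2l k0) -ck -ler_pdivrMr //.
  apply: (@le_trans _ _ (Num.bound (normc c / e))%:R); last by rewrite ler_nat.
  by apply/ltW/archi_boundP; rewrite divr_ge0 ?normc_ge0 // ltW.
move: Nc; rewrite ck cE raddfMn -[fiber x d *+ k]mulr_natl normcM normc_nat.
by rewrite mulrCA ltr_pM2l.
Qed.

(** If [fiber x] is unbounded, every factor [N] is exceeded on some [K m] with
    [m >= N] at a value of modulus at most [1 / (m + 1)].  Choosing for each [m]
    one value [c m] that exceeds every factor available on [K m] up to [m], the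
    interpolant of the [c m] violates [local_multiplication_bounded]. *)
Lemma fiber_bounded (K : nat -> set X) x :
  hausdorff_space X -> q_sequence K x ->
  exists N : nat, forall c, normc (fiber x c) <= N%:R * normc c.
Proof.
move=> hausX qK; apply: contrapT => unb.
have [cK _ sepK _] := qK.
pose expands m N c := normc c <= harmonic m /\
  exists2 y, K m y & N%:R * normc c < normc (fiber y c).
have harm0 m : 0 < harmonic m :> R by rewrite /harmonic invr_gt0 ltr0n.
have expandsP N : exists m, (N <= m)%N /\ exists c, expands m N c.
  have [c Nc] : exists c, N%:R * normc c < normc (fiber x c).
    apply: contrapT => nc; apply: unb; exists N => c; rewrite leNgt.
    by apply/negP => Nc; apply: nc; exists c.
  have Ux : nbhs x [set y | N%:R * normc c < normc (fiber y c)].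
    have /cvgrPdist_lt/(_ (normc (fiber x c) - N%:R * normc c)) :=
      @normc_continuous R X (T (cx_cst X c)) x.
    rewrite subr_gt0 => /(_ Nc); apply: filterS => y /=.
    rewrite -/(fiber x c) -/(fiber y c) => /(le_lt_trans (ler_norm _)).
    by rewrite ltrD2l ltrN2.
  have [m [Nm [y Kmy Uy]]] := q_sequence_tail N hausX qK Ux.
  exists m; split=> //.
  have [d [dm dN]] := fiber_expansion_small (harm0 m) Uy.
  by exists d; split=> //; exists y.
(* [expands m N] weakens as [N] decreases, so a value expanded by the largest
   factor below [n] that is available on [K m] serves all smaller factors. *)
have best m n : exists c, normc c <= harmonic m /\
    forall N, (N < n)%N -> (exists d, expands m N d) -> expands m N c.
  have mono N N' c : (N <= N')%N -> expands m N' c -> expands m N c.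
    move=> NN' [cm [y Kmy N'y]]; split=> //; exists y => //.
    by apply: le_lt_trans N'y; rewrite ler_wpM2r ?normc_ge0 // ler_nat.
  elim: n => [|n [c [cm IH]]]; first by exists 0; rewrite normc0 ltW.
  have [[d dn]|none] := pselect (exists d, expands m n d).
    by exists d; split=> [|N Nn _]; [case: dn|exact: (@mono _ n _ Nn dn)].
  exists c; split=> // N; rewrite ltnS leq_eqVlt => /orP[/eqP ->/none //|Nn].
  exact: IH.
have [c cP] := choice (fun m => best m m.+1).
have c0 : (fun n => normc (c n)) @ \oo --> (0 : R).
  apply: (squeeze_cvgr _ (cvg_cst _) (@cvg_harmonic R)).
  by apply: nearW => n; rewrite normc_ge0 (cP n).1.
have clK n : closed (K n) by exact: compact_closed (cK n).
have [f fK] := complex_interpolation (compact_normal hausX cptX) clK sepK c0.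
have [N fN] := local_multiplication_bounded f.
have [m [Nm [d dN]]] := expandsP N.
have [|_ [y Kmy]] := (cP m).2 N _ (ex_intro _ d dN); first by rewrite ltnS.
by rewrite -(fK m y Kmy) ltNge fN.
Qed.

Lemma q_point_decomposition (f : CX R X) x : hausdorff_space X -> q_point x ->
  T f x = T 1 x * (complex.Re (f x))%:C%C
          + T (cx_cst X 'i%C) x * (complex.Im (f x))%:C%C.
Proof.
move=> hausX [K qK]; have [N gN] := fiber_bounded hausX qK.
have lin := additive_bounded_real_linear gN.
rewrite local_multiplication_fiber {1}[f x]complexE raddfD.
rewrite -{1}[(complex.Re _)%:C%C]mulr1 ['i%C * _]mulrC !lin.
by congr (_ + _); exact: mulrC.
Qed.

(** The multiplier [a] of a function equal to [1 / (n + 1)] on the even [K n] and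
    to [i / (n + 1)] on the odd ones agrees with [T 1] on the even sets, while [a i]
    agrees with [T i] on the odd ones; [x] adheres to both families. *)
Lemma strong_q_point_i x : hausdorff_space X -> strong_q_point x ->
  T (cx_cst X 'i%C) x = 'i%C * T 1 x.
Proof.
move=> hausX [K [[cK _ sepK _] [xeven xodd]]].
have clK n : closed (K n) by exact: compact_closed (cK n).
pose u n : R[i] := if odd n then 'i%C else 1.
pose c n : R[i] := u n / n.+1%:R.
have c0 : (fun n => normc (c n)) @ \oo --> (0 : R).
  rewrite (_ : (fun _ => _) = @harmonic R); first exact: cvg_harmonic.
  apply/funext => n; rewrite /c normcM normcV normc_nat /u.
  by case: odd; rewrite ?normc_i ?normc1 mul1r.
have [f fK] := complex_interpolation (compact_normal hausX cptX) clK sepK c0.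
have [a Tf] := Tloc f.
have fiberK n y : K n y -> fiber y (u n) = a y * u n.
  move=> Kny.
  have uE : u n = f y *+ n.+1.
    by rewrite (fK n y Kny) -[RHS]mulr_natr /c mulfVK // pnatr_eq0.
  have fy : fiber y (f y) = a y * f y by rewrite -local_multiplication_fiber Tf.
  by rewrite uE raddfMn mulrnAr -fy.
have T1 : T 1 x = a x.
  apply: eq_on_closure xeven => y [n _ Ky].
  by have := fiberK _ _ Ky; rewrite /u odd_double mulr1.
have Ti : T (cx_cst X 'i%C) x = (a * cx_cst X 'i%C) x.
  apply: eq_on_closure xodd => y [n _ Ky].
  by have := fiberK _ _ Ky; rewrite /u /= odd_double.
by rewrite Ti T1 mulrC.
Qed.

End additive_local_multiplications.

Theorem theorem13 (R : realType) (X : topologicalType)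
    (cptX : compact [set: X]) (hausX : hausdorff_space X) :
  (dense [set x : X | q_point x] ->
     forall T : CX R X -> CX R X,
       additive_map T -> local_multiplication T ->
       forall f : CX R X,
         T f = T 1 * cx_Re f + T (cx_cst X ('i%C : R[i])) * cx_Im f)
  /\
  (dense [set x : X | strong_q_point x] -> eta_space R X).
Proof.
have decomposition : dense [set x : X | q_point x] ->
    forall T : CX R X -> CX R X, additive_map T -> local_multiplication T ->
    forall f, T f = T 1 * cx_Re f + T (cx_cst X 'i%C) * cx_Im f.
  move=> dq T Tadd Tloc f; apply: (eq_on_dense dq) => x.
  exact: (q_point_decomposition Tadd Tloc cptX f hausX).
split=> // dsq; split=> // T Tadd Tloc; exists (T 1) => f.
have dq : dense [set x : X | q_point x].
  move=> O O0 oO; have [x [Ox sx]] := dsq O O0 oO.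
  by exists x; split=> //; exact: strong_q_point_q_point.
have Ti : T (cx_cst X 'i%C) = cx_cst X 'i%C * T 1.
  apply: (eq_on_dense dsq) => x.
  exact: (strong_q_point_i Tadd Tloc cptX hausX).
rewrite decomposition // Ti [cx_cst X _ * _]mulrC -mulrA -mulrDr.
by congr (_ * _); apply: cx_eq => x; rewrite [RHS]complexE.
Qed.
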